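(* (1) For all $\alpha,\beta\in\mathcal{F}_{\sim}$: $\alpha\vdash_{\mathcal{L}_{S}}\beta$ if and only if $\alpha\vDash^{S}_{1}\beta$. (2) For all $\alpha,\beta\in\mathcal{F}_{\neg}$: $\alpha\vdash_{\mathcal{L}_{DS}}\beta$ if and only if $\alpha\vDash^{DS}_{0}\beta$.
   Context: Formulas $\mathcal{F}_{\sim}$ (resp. $\mathcal{F}_{\neg}$): built from propositional variables $p,q,r,\ldots$ and constants $\top,\bot$ with binary connectives $\vee,\wedge$ and the unary connective $\sim$ (resp. $\neg$). BDLL consists of the following postulates and rules (premises / conclusion), for all formulas: $\alpha\vdash\alpha$; $\alpha\vdash\beta,\ \beta\vdash\gamma\,/\,\alpha\vdash\gamma$; $\alpha\wedge\beta\vdash\alpha$, $\alpha\wedge\beta\vdash\beta$; $\alpha\vdash\beta,\ \alpha\vdash\gamma\,/\,\alpha\vdash\beta\wedge\gamma$; $\alpha\vdash\alpha\vee\beta$, $\beta\vdash\alpha\vee\beta$; $\alpha\vdash\gamma,\ \beta\vdash\gamma\,/\,\alpha\vee\beta\vdash\gamma$; $\alpha\wedge(\beta\vee\gamma)\vdash(\alpha\wedge\beta)\vee(\alpha\wedge\gamma)$; $\alpha\vdash\top$; $\bot\vdash\alpha$. $\vdash_{\mathcal{L}_S}$ is the least relation on $\mathcal{F}_{\sim}$ satisfying BDLL together with: $\alpha\vdash\beta\,/\,\sim\beta\vdash\sim\alpha$; $\sim\alpha\wedge\sim\beta\vdash\sim(\alpha\vee\beta)$; $\top\vdash\sim\bot$;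 $\alpha\wedge\beta\vdash\gamma\,/\,\alpha\wedge\sim\gamma\vdash\sim\beta$; $\alpha\wedge\sim\alpha\vdash\bot$; $\top\vdash\sim\alpha\vee\sim\sim\alpha$. $\vdash_{\mathcal{L}_{DS}}$ is the least relation on $\mathcal{F}_{\neg}$ satisfying BDLL together with: $\alpha\vdash\beta\,/\,\neg\beta\vdash\neg\alpha$; $\neg(\alpha\wedge\beta)\vdash\neg\alpha\vee\neg\beta$; $\neg\top\vdash\bot$; $\gamma\vdash\alpha\vee\beta\,/\,\neg\beta\vdash\alpha\vee\neg\gamma$; $\top\vdash\alpha\vee\neg\alpha$; $\neg\alpha\wedge\neg\neg\alpha\vdash\bot$. $\mathbf{3}_{\sim}$ is the lattice chain $0<a<1$ with $\sim 0=1$, $\sim a=\sim 1=0$. $\mathbf{3}_{\neg}$ is the lattice chain $0<a<1$ with $\neg 0=\neg a=1$, $\neg 1=0$. A valuation is a map $v$ from formulas to the algebra preserving $\vee,\wedge$ and the unary connective, with $v(\bot)=0$, $v(\top)=1$. $\alpha\vDash^{S}_{1}\beta$ means: for all valuations $v$ in $\mathbf{3}_{\sim}$, if $v(\alpha)=1$ then $v(\beta)=1$. $\alpha\vDash^{DS}_{0}\beta$ means: for all valuations $v$ in $\mathbf{3}_{\neg}$, if $v(\beta)=0$ then $v(\alpha)=0$. *)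

(* Defs.v *)
From mathcomp Require Import all_boot all_order.
Set Implicit Arguments.
Unset Strict Implicit.
Unset Printing Implicit Defensive.
Import Order.TTheory.
Local Open Scope order_scope.

(* The propositional variables are indexed by nat. *)
Inductive formS : Type :=
| VarS of nat
| TopS
| BotS
| OrS of formS & formS
| AndS of formS & formS
| SimS of formS.

Inductive formN : Type :=
| VarN of nat
| TopN
| BotN
| OrN of formN & formN
| AndN of formN & formN
| NegN of formN.

Declare Scope formS_scope.
Delimit Scope formS_scope with FS.
Bind Scope formS_scope with formS.
Notation "⊤" := TopS : formS_scope.
Notation "⊥" := BotS : formS_scope.
Notation "x ∨ y" := (OrS x y) (at level 50, left associativity) : formS_scope.
Notation "x ∧ y" := (AndS x y) (at level 40, left associativity) : formS_scope.
Notation "∼ x" := (SimS x) (at level 35, right associativity) : formS_scope.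

Declare Scope formN_scope.
Delimit Scope formN_scope with FN.
Bind Scope formN_scope with formN.
Notation "⊤" := TopN : formN_scope.
Notation "⊥" := BotN : formN_scope.
Notation "x ∨ y" := (OrN x y) (at level 50, left associativity) : formN_scope.
Notation "x ∧ y" := (AndN x y) (at level 40, left associativity) : formN_scope.
Notation "¬ x" := (NegN x) (at level 35, right associativity) : formN_scope.

Reserved Notation "x ⊢S y" (at level 70, no associativity).
Reserved Notation "x ⊢DS y" (at level 70, no associativity).

(* In both calculi, the constructors up to [_bot] form the logic BDLL of
   bounded distributive lattices. *)
Inductive derS : formS -> formS -> Prop :=
| derS_refl α : α ⊢S α
| derS_trans α β γ : α ⊢S β -> β ⊢S γ -> α ⊢S γ
| derS_andl α β : α ∧ β ⊢S α
| derS_andr α β : α ∧ β ⊢S β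
| derS_and α β γ : α ⊢S β -> α ⊢S γ -> α ⊢S β ∧ γ
| derS_orl α β : α ⊢S α ∨ β
| derS_orr α β : β ⊢S α ∨ β
| derS_or α β γ : α ⊢S γ -> β ⊢S γ -> α ∨ β ⊢S γ
| derS_distr α β γ : α ∧ (β ∨ γ) ⊢S (α ∧ β) ∨ (α ∧ γ)
| derS_top α : α ⊢S ⊤
| derS_bot α : ⊥ ⊢S α
| derS_contra α β : α ⊢S β -> ∼ β ⊢S ∼ α
| derS_sim_or α β : ∼ α ∧ ∼ β ⊢S ∼ (α ∨ β)
| derS_sim_bot : ⊤ ⊢S ∼ ⊥
| derS_antilogism α β γ : α ∧ β ⊢S γ -> α ∧ ∼ γ ⊢S ∼ β
| derS_contradiction α : α ∧ ∼ α ⊢S ⊥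
| derS_stone α : ⊤ ⊢S ∼ α ∨ ∼ ∼ α
where "x ⊢S y" := (derS x%FS y%FS).

Inductive derDS : formN -> formN -> Prop :=
| derDS_refl α : α ⊢DS α
| derDS_trans α β γ : α ⊢DS β -> β ⊢DS γ -> α ⊢DS γ
| derDS_andl α β : α ∧ β ⊢DS α
| derDS_andr α β : α ∧ β ⊢DS β
| derDS_and α β γ : α ⊢DS β -> α ⊢DS γ -> α ⊢DS β ∧ γ
| derDS_orl α β : α ⊢DS α ∨ β
| derDS_orr α β : β ⊢DS α ∨ β
| derDS_or α β γ : α ⊢DS γ -> β ⊢DS γ -> α ∨ β ⊢DS γ
| derDS_distr α β γ : α ∧ (β ∨ γ) ⊢DS (α ∧ β) ∨ (α ∧ γ)
| derDS_top α : α ⊢DS ⊤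
| derDS_bot α : ⊥ ⊢DS α
| derDS_contra α β : α ⊢DS β -> ¬ β ⊢DS ¬ α
| derDS_neg_and α β : ¬ (α ∧ β) ⊢DS ¬ α ∨ ¬ β
| derDS_neg_top : ¬ ⊤ ⊢DS ⊥
| derDS_antilogism α β γ : γ ⊢DS α ∨ β -> ¬ β ⊢DS α ∨ ¬ γ
| derDS_excluded_middle α : ⊤ ⊢DS α ∨ ¬ α
| derDS_dual_stone α : ¬ α ∧ ¬ ¬ α ⊢DS ⊥
where "x ⊢DS y" := (derDS x%FN y%FN).

(* The chain 0 < a < 1 is ['I_3] with its usual order: \bot is 0, the ordinal
   of value 1 is a, and \top (the ordinal of value 2) is 1. *)
Definition sim3 (x : 'I_3) : 'I_3 := if x == \bot then \top else \bot.
Definition neg3 (x : 'I_3) : 'I_3 := if x == \top then \bot else \top.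

Record valuationS (v : formS -> 'I_3) : Prop := ValuationS {
  valS_or : forall α β : formS, v (α ∨ β)%FS = v α `|` v β;
  valS_and : forall α β : formS, v (α ∧ β)%FS = v α `&` v β;
  valS_sim : forall α : formS, v (∼ α)%FS = sim3 (v α);
  valS_bot : v ⊥%FS = \bot;
  valS_top : v ⊤%FS = \top
}.

Record valuationN (v : formN -> 'I_3) : Prop := ValuationN {
  valN_or : forall α β : formN, v (α ∨ β)%FN = v α `|` v β;
  valN_and : forall α β : formN, v (α ∧ β)%FN = v α `&` v β;
  valN_neg : forall α : formN, v (¬ α)%FN = neg3 (v α);
  valN_bot : v ⊥%FN = \bot;
  valN_top : v ⊤%FN = \top
}.

Definition entails1_S (α β : formS) : Prop :=
  forall v : formS -> 'I_3, valuationS v -> v α = \top -> v β = \top.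

Definition entails0_DS (α β : formN) : Prop :=
  forall v : formN -> 'I_3, valuationN v -> v β = \bot -> v α = \bot.

Notation "x ⊨S1 y" := (entails1_S x%FS y%FS) (at level 70, no associativity).
Notation "x ⊨DS0 y" := (entails0_DS x%FN y%FN) (at level 70, no associativity).

(* Main.v *)
(** Completeness of L_S is proved in the style of Kalmár.  A sequent [A ⊢ B] is
    split along a variable [p] into three sequents, according to whether [p]
    takes the value 1 (add [p] on the left), 0 (add [∼ p] on the left) or [a]
    (add [∼ ∼ p] on the left and [p] on the right); the Stone axiom makes this
    split exhaustive.  Once all relevant variables are decided, [A] and [B]
    determine the value of every formula up to derivability.  The calculus L_DS
    is the order dual of L_S, so its completeness follows by exchanging ∧ with
    ∨ and reversing the chain. *)

From mathcomp Require Import all_boot all_order.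
Require Import Defs.

Set Implicit Arguments.
Unset Strict Implicit.
Unset Printing Implicit Defensive.
Import Order.TTheory.
Local Open Scope order_scope.

(** * Connectives of the three-element chain *)

(** Boolean (in)equalities on ['I_3] compute once the arguments are concrete. Leibniz equalities go
    through [eqP] first, so that the bound proofs inside ordinals do not matter. *)
Ltac decide_chain :=
  by repeat case=> [[|[|[|?]]] ?] //.

Lemma top3_le (x : 'I_3) : (\top <= x) = (x == \top).
Proof. by move: x; decide_chain. Qed.

Lemma le3_bot (x : 'I_3) : (x <= \bot) = (x == \bot).
Proof. by move: x; decide_chain. Qed.

Lemma join3_eq_top (x y : 'I_3) :
  (x `|` y == \top) = (x == \top) || (y == \top).
Proof. by move: x y; decide_chain. Qed.

Lemma join3_eq_bot (x y : 'I_3) :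
  (x `|` y == \bot) = (x == \bot) && (y == \bot).
Proof. by move: x y; decide_chain. Qed.

Lemma meet3_eq_top (x y : 'I_3) :
  (x `&` y == \top) = (x == \top) && (y == \top).
Proof. by move: x y; decide_chain. Qed.

Lemma meet3_eq_bot (x y : 'I_3) :
  (x `&` y == \bot) = (x == \bot) || (y == \bot).
Proof. by move: x y; decide_chain. Qed.

Lemma sim3_eq_top (x : 'I_3) : (sim3 x == \top) = (x == \bot).
Proof. by move: x; decide_chain. Qed.

Lemma sim3_eq_bot (x : 'I_3) : (sim3 x == \bot) = (x != \bot).
Proof. by move: x; decide_chain. Qed.

Lemma le_sim3 (x y : 'I_3) : x <= y -> sim3 y <= sim3 x.
Proof. by move: x y; decide_chain. Qed.

Lemma sim3U (x y : 'I_3) : sim3 (x `|` y) = sim3 x `&` sim3 y.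
Proof. by apply/eqP; move: x y; decide_chain. Qed.

Lemma sim3_antilogism (x y z : 'I_3) :
  x `&` y <= z -> x `&` sim3 z <= sim3 y.
Proof. by move: x y z; decide_chain. Qed.

Lemma meet3_sim (x : 'I_3) : x `&` sim3 x = \bot.
Proof. by apply/eqP; move: x; decide_chain. Qed.

Lemma sim3_stone (x : 'I_3) : sim3 x `|` sim3 (sim3 x) = \top.
Proof. by apply/eqP; move: x; decide_chain. Qed.

Lemma le_neg3 (x y : 'I_3) : x <= y -> neg3 y <= neg3 x.
Proof. by move: x y; decide_chain. Qed.

Lemma neg3I (x y : 'I_3) : neg3 (x `&` y) = neg3 x `|` neg3 y.
Proof. by apply/eqP; move: x y; decide_chain. Qed.

Lemma neg3_antilogism (x y z : 'I_3) :
  z <= x `|` y -> neg3 y <= x `|` neg3 z.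
Proof. by move: x y z; decide_chain. Qed.

Lemma join3_neg (x : 'I_3) : x `|` neg3 x = \top.
Proof. by apply/eqP; move: x; decide_chain. Qed.

Lemma neg3_dual_stone (x : 'I_3) : neg3 x `&` neg3 (neg3 x) = \bot.
Proof. by apply/eqP; move: x; decide_chain. Qed.

Lemma rev_ord3U (x y : 'I_3) : rev_ord (x `|` y) = rev_ord x `&` rev_ord y.
Proof. by apply/eqP; move: x y; decide_chain. Qed.

Lemma rev_ord3I (x y : 'I_3) : rev_ord (x `&` y) = rev_ord x `|` rev_ord y.
Proof. by apply/eqP; move: x y; decide_chain. Qed.

Lemma rev_ord3_sim (x : 'I_3) : rev_ord (sim3 x) = neg3 (rev_ord x).
Proof. by apply/eqP; move: x; decide_chain. Qed.

Lemma rev_ord3_eq_bot (x : 'I_3) : (rev_ord x == \bot) = (x == \top).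
Proof. by move: x; decide_chain. Qed.

Lemma rev_ord3_top : rev_ord (\top : 'I_3) = \bot.
Proof. exact/eqP. Qed.

Lemma rev_ord3_bot : rev_ord (\bot : 'I_3) = \top.
Proof. exact/eqP. Qed.

(** * Soundness *)

(** The induction carries the whole order: for a fixed [v], preservation of the value 1 alone does
    not pass through contraposition. *)
Lemma derS_le (v : formS -> 'I_3) (α β : formS) :
  valuationS v -> α ⊢S β -> v α <= v β.
Proof.
case=> vU vI vS v0 v1.
elim=> {α β} => [α|α β γ _ + _|α β|α β|α β γ _ + _|α β|α β|α β γ _ + _
  |α β γ|α|α|α β _|α β||α β γ _|α|α]; rewrite ?(vU, vI, vS, v0, v1) //.
- exact: le_trans.
- exact: leIl.
- exact: leIr.
- by rewrite lexI => -> ->.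
- exact: leUl.
- exact: leUr.
- by rewrite leUx => -> ->.
- by rewrite meetUr.
- exact: le_sim3.
- by rewrite sim3U.
- exact: sim3_antilogism.
- by rewrite meet3_sim.
- by rewrite sim3_stone.
Qed.

Lemma derDS_le (v : formN -> 'I_3) (α β : formN) :
  valuationN v -> α ⊢DS β -> v α <= v β.
Proof.
case=> vU vI vN v0 v1.
elim=> {α β} => [α|α β γ _ + _|α β|α β|α β γ _ + _|α β|α β|α β γ _ + _
  |α β γ|α|α|α β _|α β||α β γ _|α|α]; rewrite ?(vU, vI, vN, v0, v1) //.
- exact: le_trans.
- exact: leIl.
- exact: leIr.
- by rewrite lexI => -> ->.
- exact: leUl.
- exact: leUr.
- by rewrite leUx => -> ->.
- by rewrite meetUr.
- exact: le_neg3.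
- by rewrite neg3I.
- exact: neg3_antilogism.
- by rewrite join3_neg.
- by rewrite neg3_dual_stone.
Qed.

(** * Completeness of the Stone calculus *)

(** By distributivity, [A ∧ (B ∨ γ)] splits into two cases that both yield [B]. *)
Lemma derS_cut (A B γ : formS) : A ∧ γ ⊢S B -> A ⊢S B ∨ γ -> A ⊢S B.
Proof.
move=> AγB ABγ; apply: derS_trans (derS_and (derS_refl A) ABγ) _.
apply: derS_trans (derS_distr _ _ _) _.
by apply: derS_or => //; exact: derS_andr.
Qed.

Lemma derS_cases (A B γ δ : formS) :
  ⊤ ⊢S γ ∨ δ -> A ∧ γ ⊢S B -> A ∧ δ ⊢S B -> A ⊢S B.
Proof.
move=> γδ AγB AδB.
apply: derS_trans (derS_and (derS_refl A) (derS_trans (derS_top A) γδ)) _.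
apply: derS_trans (derS_distr _ _ _) _; exact: derS_or.
Qed.

Lemma derS_andC (α β : formS) : α ∧ β ⊢S β ∧ α.
Proof. by apply: derS_and; [exact: derS_andr | exact: derS_andl]. Qed.

Lemma derS_inconsistent (A B γ : formS) : A ⊢S γ -> A ⊢S ∼ γ -> A ⊢S B.
Proof.
move=> Aγ ANγ; apply: derS_trans (derS_and Aγ ANγ) _.
exact: derS_trans (derS_contradiction _) (derS_bot _).
Qed.

Lemma derS_sim_simI (α : formS) : α ⊢S ∼ ∼ α.
Proof.
(* Conjoining the derivable [∼ ⊥] gives the goal the shape of an antilogism of [α ∧ ∼ α ⊢S ⊥]. *)
apply: derS_trans (_ : α ∧ ∼ ⊥ ⊢S _).
  apply: derS_and (derS_refl _) _.
  exact: derS_trans (derS_top _) derS_sim_bot.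
apply: derS_antilogism; exact: derS_contradiction.
Qed.

(** Three antilogisms from [α ∧ β ⊢S α ∧ β] give in turn [α ∧ ∼ (α ∧ β) ⊢S ∼ β], then
    [∼ (α ∧ β) ∧ ∼ ∼ β ⊢S ∼ α], then the claim up to commutation. *)
Lemma derS_sim_sim_and (α β : formS) : ∼ ∼ α ∧ ∼ ∼ β ⊢S ∼ ∼ (α ∧ β).
Proof.
apply: derS_trans (derS_andC _ _) _; apply: derS_antilogism.
apply: derS_trans (derS_andC _ _) _; apply: derS_antilogism.
apply: derS_trans (derS_andC _ _) _; apply: derS_antilogism.
exact: derS_refl.
Qed.

(* [A] and [B] together pin down the value [x] of [γ]. *)
Definition decidesS (A B γ : formS) (x : 'I_3) : Prop :=
  (if x == \top then A ⊢S γ else A ∧ γ ⊢S B) /\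
  (if x == \bot then A ⊢S ∼ γ else A ⊢S ∼ ∼ γ).

(** Keeps the variables already decided when later splits enlarge [A] and [B]. *)
Lemma decidesS_weaken (A A' B B' γ : formS) (x : 'I_3) :
  A' ⊢S A -> B ⊢S B' -> decidesS A B γ x -> decidesS A' B' γ x.
Proof.
move=> A'A BB' [top bot]; split.
  case: ifP top => _ top; first exact: derS_trans top.
  apply: derS_trans BB'; apply: derS_trans top.
  apply: derS_and (derS_andr _ _); exact: derS_trans (derS_andl _ _) A'A.
by case: ifP bot => _; exact: derS_trans.
Qed.

Lemma decidesS_or (A B γ δ : formS) (x y : 'I_3) :
  decidesS A B γ x -> decidesS A B δ y ->
  decidesS A B (γ ∨ δ)%FS (x `|` y).
Proof.
move=> [γtop γbot] [δtop δbot]; split.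
  rewrite join3_eq_top; move: γtop δtop; case: eqP => _ /=.
    by move=> /derS_trans Aγ _; apply: Aγ; exact: derS_orl.
  case: eqP => _ γB; first by move/derS_trans; apply; exact: derS_orr.
  move=> δB; apply: derS_trans (derS_distr _ _ _) _; exact: derS_or.
rewrite join3_eq_bot; move: γbot δbot; case: eqP => _ /=.
  case: eqP => _ ANγ ANδ.
    apply: derS_trans (derS_sim_or _ _); exact: derS_and.
  apply: derS_trans ANδ _; do 2!apply: derS_contra; exact: derS_orr.
move=> ANγ _; apply: derS_trans ANγ _.
do 2!apply: derS_contra; exact: derS_orl.
Qed.

Lemma decidesS_and (A B γ δ : formS) (x y : 'I_3) :
  decidesS A B γ x -> decidesS A B δ y ->
  decidesS A B (γ ∧ δ)%FS (x `&` y).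
Proof.
move=> [γtop γbot] [δtop δbot]; split.
  rewrite meet3_eq_top; move: γtop δtop; case: eqP => _ /= γtop.
    case: eqP => _ δtop; first exact: derS_and.
    apply: derS_trans δtop; apply: derS_and (derS_andl _ _) _.
    exact: derS_trans (derS_andr _ _) (derS_andr _ _).
  move=> _; apply: derS_trans γtop; apply: derS_and (derS_andl _ _) _.
  exact: derS_trans (derS_andr _ _) (derS_andl _ _).
rewrite meet3_eq_bot; move: γbot δbot; case: eqP => _ /= γbot.
  move=> _; apply: derS_trans γbot _; apply: derS_contra; exact: derS_andl.
case: eqP => _ δbot.
  apply: derS_trans δbot _; apply: derS_contra; exact: derS_andr.
(* Both values are nonzero, hence so is their meet in a chain. *)
apply: derS_trans (derS_sim_sim_and _ _); exact: derS_and.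
Qed.

(** The value of [∼ γ] is 0 or 1 according to which of [∼ ∼ γ] and [∼ γ] follows from [A]; in the
    first case [A ∧ ∼ γ] is inconsistent and yields any [B]. *)
Lemma decidesS_sim (A B γ : formS) (x : 'I_3) :
  decidesS A B γ x -> decidesS A B (∼ γ)%FS (sim3 x).
Proof.
move=> [_ bot]; split.
  rewrite sim3_eq_top; case: ifP bot => // _ bot.
  apply: derS_inconsistent (derS_andr _ _) _.
  exact: derS_trans (derS_andl _ _) bot.
rewrite sim3_eq_bot; case: eqP bot => //= _ bot.
exact: derS_trans bot (derS_sim_simI _).
Qed.

Fixpoint evalS (w : nat -> 'I_3) (α : formS) : 'I_3 :=
  match α with
  | VarS i => w i
  | TopS => \top
  | BotS => \bot
  | OrS α β => evalS w α `|` evalS w β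
  | AndS α β => evalS w α `&` evalS w β
  | SimS α => sim3 (evalS w α)
  end.

Lemma evalS_valuation (w : nat -> 'I_3) : valuationS (evalS w).
Proof. by []. Qed.

(** The bound is strict, whence [i.+1] for a variable and 0 for a constant. *)
Fixpoint var_boundS (α : formS) : nat :=
  match α with
  | VarS i => i.+1
  | TopS | BotS => 0%N
  | OrS α β | AndS α β => maxn (var_boundS α) (var_boundS β)
  | SimS α => var_boundS α
  end.

(** Kalmár's lemma: decidedness passes from the variables to all formulas built from them. *)
Lemma decidesS_evalS (A B : formS) (w : nat -> 'I_3) (n : nat) :
    (forall i, (i < n)%N -> decidesS A B (VarS i) (w i)) ->
  forall γ, (var_boundS γ <= n)%N -> decidesS A B γ (evalS w γ).
Proof.
move=> decA; elim=> [i|||γ IHγ δ IHδ|γ IHγ δ IHδ|γ IHγ] /=.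
- exact: decA.
- split; first exact: derS_top.
  exact: derS_trans (derS_top _) (derS_sim_simI _).
- move=> _; split.
    exact: derS_trans (derS_andr _ _) (derS_bot _).
  exact: derS_trans (derS_top _) derS_sim_bot.
- by rewrite geq_max => /andP[/IHγ ? /IHδ ?]; exact: decidesS_or.
- by rewrite geq_max => /andP[/IHγ ? /IHδ ?]; exact: decidesS_and.
- by move/IHγ; exact: decidesS_sim.
Qed.

Lemma derS_split_vars (n : nat) (A0 B0 : formS) :
    (forall A B w, A ⊢S A0 -> B0 ⊢S B ->
       (forall i, (i < n)%N -> decidesS A B (VarS i) (w i)) -> A ⊢S B) ->
  A0 ⊢S B0.
Proof.
elim: n => [|n IHn] der.
  (* No variable has to be decided, so the assignment is arbitrary. *)
  by apply: (der _ _ (fun=> \bot)) => //; exact: derS_refl.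
apply: IHn => A B w AA0 B0B decA.
(* It suffices to decide variable [n] as well: [w] is updated at [n] to [x], and smaller indices
   stay decided by weakening. *)
have step A' B' x : A' ⊢S A -> B ⊢S B' -> decidesS A' B' (VarS n) x ->
    A' ⊢S B'.
  move=> A'A BB' decn.
  apply: (der _ _ (fun i => if i == n then x else w i)).
  - exact: derS_trans AA0.
  - exact: derS_trans BB'.
  - move=> i; rewrite ltnS leq_eqVlt; case: eqP => [->|_] //= ltin.
    by apply: decidesS_weaken (decA _ ltin).
have [al ar] := (derS_andl A, derS_andr A).
(* The case [∼ p] gives the value 0; the case [∼ ∼ p] is then split by a cut on [p] into the values
   1 ([p] on the left) and a ([p] on the right). *)
apply: (derS_cases (derS_stone (VarS n))).
  apply: (step _ _ \bot) => //; first exact: derS_refl.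
  split => /=; last exact: ar.
  apply: derS_inconsistent (derS_andr _ _) _.
  exact: derS_trans (derS_andl _ _) (ar _).
apply: (@derS_cut _ _ (VarS n)).
  apply: derS_trans (_ : A ∧ VarS n ⊢S B).
    apply: derS_and (derS_andr _ _).
    exact: derS_trans (derS_andl _ _) (al _).
  apply: (step _ _ \top) => //; first exact: derS_refl.
  by split => /=; [exact: ar | exact: derS_trans (ar _) (derS_sim_simI _)].
apply: (step _ _ (Ordinal (isT : 1 < 3)%N)) => //; first exact: derS_orl.
split => /=; last exact: ar.
exact: derS_trans (derS_andr _ _) (derS_orr _ _).
Qed.

Lemma derS_complete (α β : formS) : α ⊨S1 β -> α ⊢S β.
Proof.
move=> αβ; apply: (@derS_split_vars (maxn (var_boundS α) (var_boundS β))).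
move=> A B w Aα βB /decidesS_evalS dec.
have [decα _] := dec α (leq_maxl _ _); have [decβ _] := dec β (leq_maxr _ _).
(* If [α] has value 1, so has [β], and [A ⊢S β ⊢S B]. Otherwise [A ∧ α ⊢S B], while [A ⊢S α]. *)
case: eqP decα decβ => [/(αβ _ (evalS_valuation w)) -> _|_ decα _].
  by rewrite eqxx => Aβ; exact: derS_trans βB.
by apply: derS_trans decα; apply: derS_and Aα; exact: derS_refl.
Qed.

(** * Duality *)

Fixpoint dualS (α : formS) : formN :=
  match α with
  | VarS i => VarN i
  | TopS => BotN
  | BotS => TopN
  | OrS α β => AndN (dualS α) (dualS β)
  | AndS α β => OrN (dualS α) (dualS β)
  | SimS α => NegN (dualS α)
  end.

Fixpoint dualN (α : formN) : formS :=
  match α with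
  | VarN i => VarS i
  | TopN => BotS
  | BotN => TopS
  | OrN α β => AndS (dualN α) (dualN β)
  | AndN α β => OrS (dualN α) (dualN β)
  | NegN α => SimS (dualN α)
  end.

Lemma dualNK : cancel dualN dualS.
Proof. by elim=> //= [α -> β ->|α -> β ->|α ->]. Qed.

Lemma derDS_andC (α β : formN) : α ∧ β ⊢DS β ∧ α.
Proof. by apply: derDS_and; [exact: derDS_andr | exact: derDS_andl]. Qed.

(** BDLL postulates only one distributive law; the dual of that law is needed to translate
    derivations. *)
Lemma derDS_dual_distr (α β γ : formN) :
  (α ∨ β) ∧ (α ∨ γ) ⊢DS α ∨ (β ∧ γ).
Proof.
apply: derDS_trans (derDS_distr _ _ _) _; apply: derDS_or.
  exact: derDS_trans (derDS_andr _ _) (derDS_orl _ _).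
apply: derDS_trans (derDS_andC _ _) _.
apply: derDS_trans (derDS_distr _ _ _) _; apply: derDS_or.
  exact: derDS_trans (derDS_andr _ _) (derDS_orl _ _).
exact: derDS_trans (derDS_andC _ _) (derDS_orr _ _).
Qed.

Lemma derS_dual (α β : formS) : α ⊢S β -> dualS β ⊢DS dualS α.
Proof.
(* Apart from transitivity, whose premises are swapped, and distributivity, each rule dualizes to a
   single rule of L_DS. *)
elim=> {α β} /=; try by constructor.
- by move=> α β γ _ βα _ γβ; exact: derDS_trans γβ βα.
- by move=> *; exact: derDS_dual_distr.
Qed.

Lemma valuationN_dual (v : formS -> 'I_3) :
  valuationS v -> valuationN (fun α => rev_ord (v (dualN α))).
Proof.
case=> vU vI vS v0 v1; split=> /=.
- by move=> α β; rewrite vI rev_ord3I.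
- by move=> α β; rewrite vU rev_ord3U.
- by move=> α; rewrite vS rev_ord3_sim.
- by rewrite v1 rev_ord3_top.
- by rewrite v0 rev_ord3_bot.
Qed.

Lemma derDS_complete (α β : formN) : α ⊨DS0 β -> α ⊢DS β.
Proof.
(* It remains to show [dualN β ⊨S1 dualN α]; reversing the chain turns a valuation for it into one
   in which the value 1 has become 0. *)
move=> αβ; rewrite -(dualNK α) -(dualNK β); apply/derS_dual/derS_complete.
move=> v /valuationN_dual/αβ vαβ vβ; apply/eqP; rewrite -rev_ord3_eq_bot.
by apply/eqP/vαβ; rewrite vβ rev_ord3_top.
Qed.

Theorem theorem9 :
  (forall α β : formS, α ⊢S β <-> α ⊨S1 β) /\
  (forall α β : formN, α ⊢DS β <-> α ⊨DS0 β).
Proof.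
split=> α β; split.
- move=> αβ v vP vα; apply/eqP; rewrite -top3_le -vα; exact: derS_le.
- exact: derS_complete.
- move=> αβ v vP vβ; apply/eqP; rewrite -le3_bot -vβ; exact: derDS_le.
- exact: derDS_complete.
Qed.
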